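(* Let $\mathfrak{C}\subset\mathbb{R}^3$ be the cornet cell. There exists a CAD cell $\mathfrak{C}\odot(l,u)$ of $\mathbb{R}^4$, with $l,u:\mathfrak{C}\to\mathbb{R}$ continuous semi-algebraic functions satisfying $l<u$ on $\mathfrak{C}$, which is a non-regular sector and such that the sections $\mathfrak{C}\odot\{l\}$ and $\mathfrak{C}\odot\{u\}$ are both regular.
   Context: For $S\subseteq\mathbb{R}^n$, $\mathcal{S}^0(S)$ denotes the ring of continuous semi-algebraic functions $S\to\mathbb{R}$, and $\overline{S}$ is the Euclidean closure. For $f\in\mathcal{S}^0(S)$, the section with base $S$ and bound $f$ is the graph $S\odot\{f\}=\{(\mathbf{x},y)\in\mathbb{R}^{n+1} : \mathbf{x}\in S,\ y=f(\mathbf{x})\}$. For $l\in\mathcal{S}^0(S)\cup\{-\infty\}$ and $u\in\mathcal{S}^0(S)\cup\{+\infty\}$ with $l<u$ on $S$, the sector with base $S$ and bounds $l,u$ is $S\odot(l,u)=\{(\mathbf{x},y)\in\mathbb{R}^{n+1} : \mathbf{x}\in S,\ l(\mathbf{x})<y<u(\mathbf{x})\}$. CAD cells are defined inductively: a CAD cell of $\mathbb{R}$ is either a singleton $\{\xi\}$ with $\xi$ real algebraic, or a nonempty open interval whose endpoints are real algebraic numbers or $\pm\infty$; for $n>1$, a CAD cell of $\mathbb{R}^n$ is a section or a sector whose base is a CAD cell of $\mathbb{R}^{n-1}$. The cornet cell is the CAD cell $\mathfrak{C}=(0,2)\odot(g^-,g^+)\odot\{h\}\subset\mathbb{R}^3$,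 where $g^{\pm}(x_1)=\pm\sqrt{1-(x_1-1)^2}$ and $h(x_1,x_2)=(x_1^2+x_2^2)/(2x_1)$. Given $X\subseteq X'$ and $Y\subseteq Y'$, a homeomorphism of pairs $\varphi:(X',X)\to(Y',Y)$ is a homeomorphism $\varphi:X'\to Y'$ with $\varphi(X)=Y$. Two subsets $X\subset\mathbb{R}^n$ and $Y\subset\mathbb{R}^m$ are equiregular if there is a homeomorphism of pairs $(\overline{X},X)\to(\overline{Y},Y)$. A subset $S\subseteq\mathbb{R}^n$ is regular if it is a singleton or is equiregular with an open ball in $\mathbb{R}^d$ for some integer $d\ge 1$. *)

(* Defs.v *)
From HB Require Import structures.
From mathcomp Require Import all_boot all_order all_algebra.
From mathcomp Require Import all_classical all_reals all_analysis.
(* Not imported: the notations of [mpoly] clash with those of the analysis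
   library. *)
From mathcomp Require mpoly.

Set Implicit Arguments.
Unset Strict Implicit.
Unset Printing Implicit Defensive.

Import Order.TTheory GRing.Theory Num.Theory.
Import numFieldNormedType.Exports.

Local Open Scope classical_set_scope.
Local Open Scope ring_scope.

(* R^n is ['rV[R]_n] with the product topology of the library, which is the
   Euclidean topology. *)

Definition real_algebraic (R : realType) (x : R) : Prop :=
  algebraicOver (ratr : rat -> R) x.

(* The smallest class of subsets of R^n
   containing the sets {P > 0}, P a polynomial with real coefficients, and
   closed under complement and under finite unions and intersections. *)
Inductive semialgebraic (R : realType) (n : nat) : set 'rV[R]_n -> Prop :=
| semialgebraic_pos (p : mpoly.mpoly n R) :
    semialgebraic [set x | 0 < mpoly.meval (fun i => x ord0 i) p]
| semialgebraic_compl (A : set 'rV[R]_n) :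
    semialgebraic A -> semialgebraic (~` A)
| semialgebraic_union (A B : set 'rV[R]_n) :
    semialgebraic A -> semialgebraic B -> semialgebraic (A `|` B)
| semialgebraic_inter (A B : set 'rV[R]_n) :
    semialgebraic A -> semialgebraic B -> semialgebraic (A `&` B).

(* A point of R^(n+1) is (x, y) with x = [rV_init z] and y = [z ord0 ord_max]. *)
Definition rV_init (R : realType) (n : nat) (z : 'rV[R]_n.+1) : 'rV[R]_n :=
  \row_i z ord0 (widen_ord (leqnSn n) i).

Definition cell_section (R : realType) (n : nat)
    (S : set 'rV[R]_n) (f : 'rV[R]_n -> R) : set 'rV[R]_n.+1 :=
  [set z | S (rV_init z) /\ z ord0 ord_max = f (rV_init z)].

Definition cell_sector (R : realType) (n : nat)
    (S : set 'rV[R]_n) (l u : 'rV[R]_n -> \bar R) : set 'rV[R]_n.+1 :=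
  [set z | S (rV_init z) /\
     (l (rV_init z) < (z ord0 ord_max)%:E < u (rV_init z))%E].

(* Membership in S^0(S). A function on S is represented by a total function,
   whose values outside S are irrelevant; it is semi-algebraic when its graph
   over S is a semi-algebraic set. *)
Definition continuous_semialgebraic (R : realType) (n : nat)
    (S : set 'rV[R]_n) (f : 'rV[R]_n -> R) : Prop :=
  {within S, continuous f} /\ semialgebraic (cell_section S f).

Definition lower_bound (R : realType) (n : nat)
    (S : set 'rV[R]_n) (l : 'rV[R]_n -> \bar R) : Prop :=
  l = cst -oo%E \/
  exists2 f : 'rV[R]_n -> R, continuous_semialgebraic S f & l = EFin \o f.

Definition upper_bound (R : realType) (n : nat)
    (S : set 'rV[R]_n) (u : 'rV[R]_n -> \bar R) : Prop :=
  u = cst +oo%E \/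
  exists2 f : 'rV[R]_n -> R, continuous_semialgebraic S f & u = EFin \o f.

Definition open_interval (R : realType) (a b : \bar R) : set 'rV[R]_1 :=
  [set x | (a < (x ord0 ord0)%:E < b)%E].

Definition left_endpoint (R : realType) (a : \bar R) : Prop :=
  a = -oo%E \/ exists2 xi : R, real_algebraic xi & a = xi%:E.

Definition right_endpoint (R : realType) (b : \bar R) : Prop :=
  b = +oo%E \/ exists2 xi : R, real_algebraic xi & b = xi%:E.

Inductive cad_cell (R : realType) : forall n : nat, set 'rV[R]_n -> Prop :=
| cad_cell_point (xi : R) :
    real_algebraic xi -> cad_cell [set x : 'rV[R]_1 | x ord0 ord0 = xi]
| cad_cell_interval (a b : \bar R) :
    left_endpoint a -> right_endpoint b -> (a < b)%E ->
    cad_cell (open_interval a b)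
| cad_cell_section (n : nat) (S : set 'rV[R]_n) (f : 'rV[R]_n -> R) :
    cad_cell S -> continuous_semialgebraic S f ->
    cad_cell (cell_section S f)
| cad_cell_sector (n : nat) (S : set 'rV[R]_n) (l u : 'rV[R]_n -> \bar R) :
    cad_cell S -> lower_bound S l -> upper_bound S u ->
    (forall x, S x -> (l x < u x)%E) ->
    cad_cell (cell_sector S l u).

Definition cornet_g (R : realType) (x : 'rV[R]_1) : R :=
  Num.sqrt (1 - (x ord0 ord0 - 1) ^+ 2).

Definition cornet_h (R : realType) (x : 'rV[R]_2) : R :=
  (x ord0 ord0 ^+ 2 + x ord0 ord_max ^+ 2) / (2 * x ord0 ord0).

Definition cornet (R : realType) : set 'rV[R]_3 :=
  cell_section
    (cell_sector (open_interval 0%:E 2%:E)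
       (fun x => (- cornet_g x)%:E) (fun x => (cornet_g x)%:E))
    (@cornet_h R).
Arguments cornet : clear implicits.

(* A homeomorphism of pairs (X', X) -> (Y', Y), with inverse g; both maps are
   represented by total functions and only used on X' and Y'. *)
Definition pair_homeomorphism (T U : topologicalType)
    (X' X : set T) (Y' Y : set U) (f : T -> U) (g : U -> T) : Prop :=
  [/\ set_fun X' Y' f /\ set_fun Y' X' g,
      {in X', cancel f g} /\ {in Y', cancel g f},
      {within X', continuous f},
      {within Y', continuous g} &
      f @` X = Y].

Definition equiregular (R : realType) (n m : nat)
    (X : set 'rV[R]_n) (Y : set 'rV[R]_m) : Prop :=
  exists (f : 'rV[R]_n -> 'rV[R]_m) (g : 'rV[R]_m -> 'rV[R]_n),
    pair_homeomorphism (closure X) X (closure Y) Y f g.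

(* The library's [ball] on ['rV[R]_d] is the one of the sup norm. *)
Definition euclidean_ball (R : realType) (d : nat) (c : 'rV[R]_d) (r : R) :
    set 'rV[R]_d :=
  [set x | \sum_i (x ord0 i - c ord0 i) ^+ 2 < r ^+ 2].

Definition regular_set (R : realType) (n : nat) (S : set 'rV[R]_n) : Prop :=
  (exists x : 'rV[R]_n, S = [set x]) \/
  exists (d : nat) (c : 'rV[R]_d) (r : R),
    [/\ (1 <= d)%N, 0 < r & equiregular S (euclidean_ball c r)].

(* Main.v *)
(* The closure of the cornet is a cone over a circle, hence a closed disc, and
   the cornet is this disc minus the slit [x = y = 0].  The function
   [l = y / sqrt (2 x)] has limits [- sqrt z] and [sqrt z] on the two sides of
   the slit, so the closure of its graph is the disc cut open along the slit: it
   is parametrised by the half-disc [a >= 0], [a^2 + b^2 <= 1] through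
   [(2 a^2, 2 a b, a^2 + b^2, b)], and the same holds for [u = l + 2].
   The intervals [-sqrt z, 2 - sqrt z] and [sqrt z, 2 + sqrt z] overlap, so
   over a point of the slit the two sides of the sector are glued in its closure:
   near the glued point the sector is split in two pieces by the sign of [y],
   which cannot happen at a boundary point of a ball. *)
Require Import Defs.
From mathcomp Require Import all_boot all_order all_algebra.
From mathcomp Require Import all_classical all_reals all_analysis.
From mathcomp Require Import ring lra.
From mathcomp Require Import -(notations) mpoly.

Set Implicit Arguments.
Unset Strict Implicit.
Unset Printing Implicit Defensive.

Import Order.TTheory GRing.Theory Num.Theory.
Import numFieldNormedType.Exports.

Local Open Scope classical_set_scope.
Local Open Scope ring_scope.

(** * Closures and homeomorphisms of pairs *)

Lemma eq_on_closure (T U : topologicalType) (f g : T -> U) (X : set T) :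
  hausdorff_space U -> continuous f -> continuous g ->
  {in X, f =1 g} -> {in closure X, f =1 g}.
Proof.
move=> hU cf cg fg x; rewrite inE => Xx; apply: hU => A B fA gB.
have [t [Xt [At Bt]]] := Xx _ (@filterI _ (nbhs x) _ (f @^-1` A) (g @^-1` B)
  (cf x _ fA) (cg x _ gB)).
by exists (f t); split=> //; rewrite fg ?inE.
Qed.

Lemma image_closure_sub (T U : topologicalType) (f : T -> U)
    (X : set T) (Y : set U) :
  continuous f -> set_fun X Y f -> set_fun (closure X) (closure Y) f.
Proof.
move=> cf fXY x Xx B /cf fB; have [t [Xt Bt]] := Xx _ fB.
by exists (f t); split=> //; exact: fXY.
Qed.

(** Since both maps are continuous on the whole space, the cancellation identities pass from [X] and
    [Y] to their closures by density. Only the open parts then have to be checked. *)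
Lemma pair_homeomorphism_closure (T U : topologicalType) (X : set T)
    (Y : set U) (f : T -> U) (g : U -> T) :
  hausdorff_space T -> hausdorff_space U -> continuous f -> continuous g ->
  set_fun X Y f -> set_fun Y X g -> {in X, cancel f g} -> {in Y, cancel g f} ->
  pair_homeomorphism (closure X) X (closure Y) Y f g.
Proof.
move=> hT hU cf cg fXY gYX fK gK; split.
- by split; exact: image_closure_sub.
- split=> x Xx.
  + apply: (@eq_on_closure _ _ (g \o f) id X hT _ _ fK x Xx) => z; last exact: cvg_id.
    by apply: continuous_comp; [exact: cf|exact: cg].
  + apply: (@eq_on_closure _ _ (f \o g) id Y hU _ _ gK x Xx) => z; last exact: cvg_id.
    by apply: continuous_comp; [exact: cg|exact: cf].
- exact: continuous_subspaceT.
- exact: continuous_subspaceT.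
- apply/seteqP; split => [_ [x Xx <-]|y Yy]; first exact: fXY.
  by exists (g y); [exact: gYX|rewrite gK ?inE].
Qed.

Lemma continuous_mx (T : topologicalType) (U : topologicalType) m n
    (f : T -> 'M[U]_(m, n)) :
  (forall i j, continuous (fun x => f x i j)) -> continuous f.
Proof.
move=> cf x A [P xP PA]; apply: (@filterS _ (nbhs x) _ (fun y => forall i j, P i j (f y i j))).
  by move=> y Py; exact: PA.
apply: filter_forall => i; apply: filter_forall => j; exact: cf.
Qed.

(** * Convexity and the boundary points of a ball *)

Lemma convex_comb_lt (R : realFieldType) (a b m s : R) :
  a < m -> b < m -> 0 <= s <= 1 -> (1 - s) * a + s * b < m.
Proof.
(* One of the two weights is at least [1 / 2]; the strict inequality it multiplies stays strict. *)
by move=> am bm /andP[s0 s1]; have [s2|s2] := leP s (1 / 2); nra.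
Qed.

Lemma euclidean_ball_convex (R : realType) d (c x y : 'rV[R]_d) (r s : R) :
  euclidean_ball c r x -> euclidean_ball c r y -> 0 <= s <= 1 ->
  euclidean_ball c r (x + s *: (y - x)).
Proof.
rewrite /euclidean_ball /= => Bx By s01; have /andP[s0 s1] := s01.
apply: (@le_lt_trans _ _ ((1 - s) * \sum_i (x ord0 i - c ord0 i) ^+ 2 +
    s * \sum_i (y ord0 i - c ord0 i) ^+ 2)); last first.
  exact: convex_comb_lt.
rewrite !mulr_sumr -big_split; apply: ler_sum => i _.
rewrite !mxE; move: (x _ _) (y _ _) (c _ _) => a b e.
(* This is exactly the convexity defect of the square: the combination of the squares minus the
   square of the combination. *)
have : 0 <= s * (1 - s) * (a - b) ^+ 2.
  by rewrite mulr_ge0 ?sqr_ge0// mulr_ge0// subr_ge0.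
rewrite -subr_ge0; congr (_ <= _) => /=; ring.
Qed.

(** Neighbourhoods are given by sup-norm balls, so a segment has to be kept inside these as well as
    inside the Euclidean ball. *)
Lemma ball_mx_convex (R : realType) d (q x y : 'rV[R]_d) (e s : R) :
  ball q e x -> ball q e y -> 0 <= s <= 1 -> ball q e (x + s *: (y - x)).
Proof.
move=> [e0 Bx] [_ By] s01; split=> // i j.
move: (Bx i j) (By i j); rewrite /ball /= !mxE !ltr_norml.
move: (q _ _) (x _ _) (y _ _) => a b c /andP[b1 b2] /andP[c1 c2].
have lo : (1 - s) * (b - a) + s * (c - a) < e.
  by apply: convex_comb_lt => //; lra.
have hi : (1 - s) * (a - b) + s * (a - c) < e.
  by apply: convex_comb_lt => //; lra.
lra.
Qed.

(* A boundary point of a ball has arbitrarily small neighbourhoods that meet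
   the ball in a convex set. *)
Lemma not_regular_split_boundary (R : realType) n (S U : set 'rV[R]_n)
    (k : 'rV[R]_n -> R) (p : 'rV[R]_n) :
  continuous k -> nbhs p U -> (forall x, S x -> U x -> k x != 0) ->
  closure (S `&` [set x | k x < 0]) p -> closure (S `&` [set x | 0 < k x]) p ->
  ~ regular_set S.
Proof.
move=> ck pU kU pneg ppos [[x Sx]|[d [c [r [_ _ [f [g]]]]]]].
  (* If [S] is a singleton, its only point would have [k] both negative and positive. *)
  have [y [[/= + ky] _]] := pneg setT filterT; rewrite Sx => /= yx.
  have [z [[/= + kz] _]] := ppos setT filterT; rewrite Sx => /= zx.
  by move: (lt_trans ky kz); rewrite yx zx ltxx.
set B := euclidean_ball c r.
case=> -[fSB gBS] [fK gK] /subspace_continuousP cf /subspace_continuousP cg fS.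
have Sp : closure S p by apply: closureS pneg; exact: subIsetl.
have SclS := @subset_closure _ S; have BclB := @subset_closure _ B.
have gf x : closure S x -> g (f x) = x by move=> Sx; apply: fK; rewrite inE.
have gB y : B y -> S (g y).
  by rewrite -{1}fS => -[x Sx <-]; have /gf -> := SclS _ Sx.
have fB x : S x -> B (f x) by rewrite -fS => Sx; exists x.
have gU : \forall y \near f p, closure B y -> U (g y).
  have gpU : nbhs (g (f p)) U by rewrite gf.
  exact: (cg (f p) (fSB _ Sp) U gpU).
have [e /= e0 eU] := (iffLR (nbhs_ballP _ _) gU).
have fe : \forall x \near p, closure S x -> ball (f p) e (f x).
  exact: (cf p Sp (ball (f p) e) (nbhsx_ballx _ _ e0)).
have [x [[Sx /= kx] xe]] := pneg _ fe.
have [y [[Sy /= ky] ye]] := ppos _ fe.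
have {xe}fx : ball (f p) e (f x) by apply: xe; exact: SclS.
have {ye}fy : ball (f p) e (f y) by apply: ye; exact: SclS.
(* The segment joins the images of a point with [k < 0] and a point with [k > 0]. Pulled back by [g]
   it stays in [S] and in [U], so the intermediate value theorem yields a forbidden zero of [k]. *)
pose w (t : R) := f x + t *: (f y - f x).
have wB t : 0 <= t <= 1 -> B (w t).
  by apply: euclidean_ball_convex; exact: fB.
have wU t : 0 <= t <= 1 -> U (g (w t)).
  move=> t01; apply: eU; first exact: ball_mx_convex.
  by apply: BclB; exact: wB.
have cw : continuous w.
  by move=> t; apply: cvgD; [exact: cvg_cst|apply: cvgZr_tmp; exact: cvg_id].
have ckgw : {within `[0, 1], continuous (k \o g \o w)}.
  apply/subspace_continuousP => t; rewrite /= in_itv /= => t01.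
  apply: (@cvg_comp _ _ _ (g \o w) k _ (nbhs (g (w t)))); last exact: ck.
  (* [g] is continuous only relative to [closure B], so the limit is taken along this filter; [w]
     stays in [B] on the unit interval. *)
  apply: (@cvg_comp _ _ _ w g _ (within (closure B) (nbhs (w t)))).
    move=> A /(cw t) At.
    change (nbhs t [set s | [set` `[0, 1]] s -> A (w s)]).
    apply: (@filterS _ (nbhs t) _ _ _ _ At) => s As; rewrite /= in_itv /= => s01.
    by apply: As; apply: BclB; exact: wB.
  by apply: cg; apply: BclB; exact: wB.
have w0 : g (w 0) = x by rewrite /w scale0r addr0; apply: gf; exact: SclS.
have w1 : g (w 1) = y by rewrite /w scale1r addrC subrK; apply: gf; exact: SclS.
have [|t] := @IVT _ (k \o g \o w) 0 1 0 ler01 ckgw.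
  by rewrite /= w0 w1 ge_min le_max (ltW kx) (ltW ky) orbT.
rewrite in_itv /= => t01 kt.
by have := kU _ (gB _ (wB _ t01)) (wU _ t01); rewrite kt eqxx.
Qed.

(** * Polynomial functions, semi-algebraic sets and coordinates *)

Definition polynomial_fun (R : realType) n (F : 'rV[R]_n -> R) : Prop :=
  exists p : mpoly.mpoly n R, forall x, F x = mpoly.meval (fun i => x ord0 i) p.

Section PolynomialFun.
Variables (R : realType) (n : nat).
Implicit Types F G : 'rV[R]_n -> R.

Lemma polynomial_cst (c : R) : polynomial_fun (fun _ : 'rV[R]_n => c).
Proof. by exists (mpoly.mpolyC n c) => x; rewrite mpoly.mevalC. Qed.

Lemma polynomial_coord (i : 'I_n) : polynomial_fun (fun x : 'rV[R]_n => x ord0 i).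
Proof.
by exists (mpoly.mpolyX R (mpoly.mnm1 i)) => x; rewrite mpoly.mevalXU.
Qed.

Lemma polynomialD F G : polynomial_fun F -> polynomial_fun G ->
  polynomial_fun (fun x => F x + G x).
Proof. by move=> [p Fp] [q Gq]; exists (p + q) => x; rewrite mpoly.mevalD Fp Gq. Qed.

Lemma polynomialN F : polynomial_fun F -> polynomial_fun (fun x => - F x).
Proof. by move=> [p Fp]; exists (- p) => x; rewrite mpoly.mevalN Fp. Qed.

Lemma polynomialM F G : polynomial_fun F -> polynomial_fun G ->
  polynomial_fun (fun x => F x * G x).
Proof. by move=> [p Fp] [q Gq]; exists (p * q) => x; rewrite mpoly.mevalM Fp Gq. Qed.

Lemma polynomialX F m : polynomial_fun F -> polynomial_fun (fun x => F x ^+ m).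
Proof. by move=> [p Fp]; exists (p ^+ m) => x; rewrite rmorphXn /= Fp. Qed.

Lemma polynomial_continuous F : polynomial_fun F -> continuous F.
Proof.
move=> [p Fp] x.
have {Fp}-> : F = fun y => \sum_(m <- mpoly.msupp p)
    mpoly.mcoeff m p * \prod_i y ord0 i ^+ m i.
  by apply/funext => y; rewrite Fp mpoly.mevalE.
rewrite unlock; elim: (mpoly.msupp p : seq _) => [|m s IHs] /=.
  exact: cst_continuous.
apply: (continuousD _ IHs); apply: continuousM; first exact: cst_continuous.
elim: (index_enum _) => [|i r IHr] /=; first exact: cst_continuous.
apply: (continuousM _ IHr).
(* Exponent 1 is a separate case because [x ^+ 1] reduces to [x], not to [x * 1]. *)
elim: (m i : nat) => [|[|k] IHk]; first exact: cst_continuous.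
  exact: coord_continuous.
by apply: (continuousM _ IHk); exact: coord_continuous.
Qed.

Lemma continuous_sqrt_polynomial F :
  polynomial_fun F -> continuous (fun x => Num.sqrt (F x)).
Proof.
move=> /polynomial_continuous cF x.
by apply: (continuous_comp (cF x)); exact: sqrt_continuous.
Qed.

Lemma semialgebraic_gt0 F : polynomial_fun F -> semialgebraic [set x | 0 < F x].
Proof. by move=> [p Fp]; rewrite (funext Fp); exact: semialgebraic_pos. Qed.

Lemma semialgebraic_ge0 F : polynomial_fun F -> semialgebraic [set x | 0 <= F x].
Proof.
move=> /polynomialN /semialgebraic_gt0 /semialgebraic_compl.
by congr semialgebraic; apply/seteqP; split=> x /=; rewrite oppr_gt0 (leNgt 0) =>
  /negP.
Qed.

Lemma semialgebraic_eq0 F : polynomial_fun F -> semialgebraic [set x | F x = 0].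
Proof.
move=> Fp; have := semialgebraic_inter (semialgebraic_ge0 Fp)
  (semialgebraic_ge0 (polynomialN Fp)).
congr semialgebraic; apply/seteqP; split=> x /=; last by move=> ->; rewrite oppr0.
by rewrite oppr_ge0 => -[F0 F0']; apply/le_anti; rewrite F0 F0'.
Qed.

End PolynomialFun.

(** Indices in [nat] let the same coordinate be named in every dimension, so that [rV_init] can be
    rewritten away. An index above [n] falls back to coordinate 0. *)
Definition entry (R : realType) n (k : nat) (x : 'rV[R]_n.+1) : R :=
  x ord0 (inord k).

Definition vec (R : realType) n (s : seq R) : 'rV[R]_n.+1 := \row_j s`_j.

Section Entry.
Variables (R : realType) (n : nat).

Lemma ord0E (x : 'rV[R]_n.+1) : x ord0 ord0 = entry 0 x.
Proof. by congr (x _ _); apply: val_inj; rewrite /= inordK. Qed.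

Lemma ord_maxE (x : 'rV[R]_n.+1) : x ord0 ord_max = entry n x.
Proof. by congr (x _ _); apply: val_inj; rewrite /= inordK. Qed.

Lemma entry_rV_init k (x : 'rV[R]_n.+2) :
  (k < n.+1)%N -> entry k (rV_init x) = entry k x.
Proof.
move=> kn; rewrite /entry mxE; congr (x _ _); apply: val_inj.
by rewrite /= !inordK// ltnW.
Qed.

Lemma entry_vec k (s : seq R) : (k < n.+1)%N -> entry k (vec n s) = s`_k.
Proof. by move=> kn; rewrite /entry mxE inordK. Qed.

Lemma eq_entry (x y : 'rV[R]_n.+1) :
  (forall k, (k < n.+1)%N -> entry k x = entry k y) -> x = y.
Proof.
move=> xy; apply/rowP => j; have := xy j (ltn_ord j).
by rewrite /entry inord_val.
Qed.

Lemma polynomial_entry k : polynomial_fun (fun x : 'rV[R]_n.+1 => entry k x).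
Proof. exact: polynomial_coord. Qed.

Lemma vec_continuous (T : topologicalType) (s : T -> seq R) :
  (forall k, (k < n.+1)%N -> continuous (fun x => (s x)`_k)) ->
  continuous (fun x => vec n (s x)).
Proof.
move=> cs; apply: continuous_mx => i j.
by under eq_fun do rewrite mxE; exact: cs.
Qed.

End Entry.

Ltac polynomiality := repeat first [exact: polynomial_cst |
  exact: polynomial_entry | apply: polynomialX | apply: polynomialN |
  apply: polynomialD | apply: polynomialM].

Lemma real_algebraic_nat (R : realType) k : real_algebraic (k%:R : R).
Proof.
by rewrite /real_algebraic -(ratr_nat R k); exact: algebraic_id.
Qed.

(** * The cornet as a CAD cell *)

Section Cornet.
Variable R : realType.

Definition cornet_disc : set 'rV[R]_2 :=
  cell_sector (open_interval 0%:E 2%:E)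
    (fun x => (- cornet_g x)%:E) (fun x => (cornet_g x)%:E).

(** Squaring [|y| < sqrt (1 - (x - 1)^2)] gives the open unit disc centred at [(1, 0)]. *)
Lemma cornet_discP (x : 'rV[R]_2) :
  cornet_disc x <-> 0 < entry 0 x /\ entry 0 x ^+ 2 + entry 1 x ^+ 2 < 2 * entry 0 x.
Proof.
rewrite /cornet_disc /cell_sector /open_interval /cornet_g /= !ord0E.
rewrite entry_rV_init// ord_maxE !lte_fin -ltr_norml -sqrtr_sqr.
move: (entry 0 x) (entry 1 x) => a b; split=> [[/andP[a0 a2]]|[a0 ab]].
  by rewrite ltr_sqrt; [split=> //; nra|nra].
split; first by apply/andP; split => //; nra.
by rewrite ltr_sqrt; nra.
Qed.

(** Clearing the denominator [2 x > 0] of [cornet_h] leaves the quadratic cone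
    [2 x z = x^2 + y^2]. *)
Lemma cornetP (x : 'rV[R]_3) :
  cornet R x <-> [/\ 0 < entry 0 x,
    entry 0 x ^+ 2 + entry 1 x ^+ 2 < 2 * entry 0 x &
    2 * entry 0 x * entry 2 x = entry 0 x ^+ 2 + entry 1 x ^+ 2].
Proof.
change (cornet R x) with
  (cornet_disc (rV_init x) /\ x ord0 ord_max = cornet_h (rV_init x)).
rewrite /cornet_h cornet_discP !ord0E !ord_maxE !entry_rV_init//.
move: (entry 0 x) (entry 1 x) (entry 2 x) => a b e; split.
  by move=> [[a0 ab] ->]; split=> //; field; rewrite gt_eqF.
move=> [a0 ab abe]; split=> //; rewrite -abe; field; first by rewrite gt_eqF.
Qed.

Lemma cornet_g_continuous : continuous (@cornet_g R).
Proof.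
rewrite (_ : @cornet_g R =
    fun x => Num.sqrt (1 - (entry 0 x - 1) ^+ 2)); last first.
  by apply/funext => x; rewrite /cornet_g ord0E.
by apply: continuous_sqrt_polynomial; polynomiality.
Qed.

(** The sign [s] treats both bounds at once: the graph is the half of the circle
    [y^2 + (x - 1)^2 = 1] where [s y >= 0], over [0 < x < 2]. *)
Lemma cornet_g_semialgebraic (s : R) : s ^+ 2 = 1 ->
  continuous_semialgebraic (open_interval 0%:E 2%:E) (fun x => s * cornet_g x).
Proof.
move=> s2; split.
  apply: continuous_subspaceT => x; apply: continuousM.
    exact: cst_continuous.
  exact: cornet_g_continuous.
pose F (x : 'rV[R]_2) := entry 0 x * (2 - entry 0 x).
pose E (x : 'rV[R]_2) := s * entry 1 x.
pose G (x : 'rV[R]_2) := entry 1 x ^+ 2 + (entry 0 x - 1) ^+ 2 - 1.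
suff -> : cell_section (open_interval 0%:E 2%:E) (fun x => s * cornet_g x) =
    [set x | 0 < F x] `&` ([set x | 0 <= E x] `&` [set x | G x = 0]).
  apply: semialgebraic_inter; first by apply: semialgebraic_gt0; rewrite /F; polynomiality.
  apply: semialgebraic_inter.
    by apply: semialgebraic_ge0; rewrite /E; polynomiality.
  by apply: semialgebraic_eq0; rewrite /G; polynomiality.
rewrite /cell_section /open_interval /cornet_g /F /G /E.
symmetry; apply/seteqP; split=> x /=; rewrite !ord0E entry_rV_init// ord_maxE !lte_fin;
  move: (entry 0 x) (entry 1 x) => a b.
  move=> [a02 [sb ab]]; split; first by apply/andP; split; nra.
  suff -> : 1 - (a - 1) ^+ 2 = (s * b) ^+ 2.
    by rewrite sqrtr_sqr ger0_norm// mulrA -expr2 s2 mul1r.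
  by rewrite exprMn s2; lra.
move=> [/andP[a0 a2] ->]; split; first nra.
have a1 : 0 <= 1 - (a - 1) ^+ 2 by nra.
rewrite mulrA -expr2 s2 mul1r sqrtr_ge0; split=> //.
by rewrite exprMn s2 sqr_sqrtr//; ring.
Qed.

Lemma cornet_h_semialgebraic :
  continuous_semialgebraic cornet_disc (@cornet_h R).
Proof.
split.
  apply: continuous_in_subspaceT => x; rewrite inE => /cornet_discP[x0 _].
  rewrite (_ : @cornet_h R = fun y =>
      (entry 0 y ^+ 2 + entry 1 y ^+ 2) * (2 * entry 0 y)^-1); last first.
    by apply/funext => y; rewrite /cornet_h ord0E ord_maxE.
  apply: (@continuousM _ _ (fun y => entry 0 y ^+ 2 + entry 1 y ^+ 2)
      (fun y => (2 * entry 0 y)^-1)).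
    by apply: polynomial_continuous; polynomiality.
  apply: continuousV; first by rewrite mulf_neq0 ?pnatr_eq0// gt_eqF.
  by apply: polynomial_continuous; polynomiality.
pose F (x : 'rV[R]_3) := entry 0 x.
pose E (x : 'rV[R]_3) := 2 * entry 0 x - (entry 0 x ^+ 2 + entry 1 x ^+ 2).
pose G (x : 'rV[R]_3) :=
  2 * entry 0 x * entry 2 x - (entry 0 x ^+ 2 + entry 1 x ^+ 2).
suff -> : cell_section cornet_disc (@cornet_h R) =
    [set x | 0 < F x] `&` ([set x | 0 < E x] `&` [set x | G x = 0]).
  apply: semialgebraic_inter; first by apply: semialgebraic_gt0; rewrite /F; polynomiality.
  apply: semialgebraic_inter.
    by apply: semialgebraic_gt0; rewrite /E; polynomiality.
  by apply: semialgebraic_eq0; rewrite /G; polynomiality.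
rewrite -[LHS]/(cornet R) /F /G /E; symmetry; apply/seteqP; split=> x.
  by move=> [/= x0 [xy xz]]; apply/cornetP; split=> //; lra.
by move=> /cornetP[x0 xy xz]; split=> //=; split; lra.
Qed.

Lemma cad_cell_cornet : cad_cell (cornet R).
Proof.
apply: cad_cell_section; last exact: cornet_h_semialgebraic.
apply: cad_cell_sector.
- apply: cad_cell_interval; last by rewrite lte_fin.
  + by right; exists 0 => //; exact: (real_algebraic_nat R 0).
  + by right; exists 2 => //; exact: (real_algebraic_nat R 2).
- right; exists (fun x => - cornet_g x) => //.
  have := @cornet_g_semialgebraic (- 1).
  rewrite sqrrN expr1n => /(_ erefl).
  by under eq_fun do rewrite mulN1r.
- right; exists (@cornet_g R) => //.
  have := @cornet_g_semialgebraic 1; rewrite expr1n => /(_ erefl).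
  by under eq_fun do rewrite mul1r.
- move=> x; rewrite /open_interval /= !lte_fin => /andP[x0 x2].
  have : 0 < cornet_g x by rewrite sqrtr_gt0; nra.
  by lra.
Qed.


(** * The slit function and the half-disc chart *)

(* On the cornet [y / sqrt (2 x)] equals [sqrt z * sin phi], where [phi] is the
   polar angle of [(x, y)]; on the two sides of the slit [x = y = 0] of the
   closed cone it tends to [- sqrt z] and [sqrt z]. *)
Definition slit_function (c : R) (x : 'rV[R]_3) : R :=
  entry 1 x / Num.sqrt (2 * entry 0 x) + c.

(* Coordinates [a = sqrt z * cos phi] and [b = sqrt z * sin phi]. *)
Definition half_disc_chart (c : R) (v : 'rV[R]_2) : 'rV[R]_4 :=
  vec 3 [:: 2 * entry 0 v ^+ 2; 2 * entry 0 v * entry 1 v;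
            entry 0 v ^+ 2 + entry 1 v ^+ 2; entry 1 v + c].

(** Here [2 x] is the square of [2 a], so the quotient [y / sqrt (2 x)] reduces to [b]. *)
Lemma slit_functionP (a b : R) (x : 'rV[R]_3) (c : R) : 0 < a ->
  entry 0 x = 2 * a ^+ 2 -> entry 1 x = 2 * a * b -> slit_function c x = b + c.
Proof.
move=> a0 xa xb; rewrite /slit_function xa xb.
have -> : 2 * (2 * a ^+ 2) = (2 * a) ^+ 2 by ring.
rewrite sqrtr_sqr ger0_norm; last by lra.
by field; rewrite gt_eqF.
Qed.

(** Take [a = sqrt (x / 2)] and [b = y / (2 a)]. Then [x^2 + y^2 = 4 a^2 (a^2 + b^2)], and dividing
    by [4 a^2] turns the cone equation into [z = a^2 + b^2] and the disc inequality into
    [a^2 + b^2 < 1]. *)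
Lemma cornet_half_disc (x : 'rV[R]_3) :
  cornet R x <-> exists a b : R, [/\ 0 < a, a ^+ 2 + b ^+ 2 < 1 &
    [/\ entry 0 x = 2 * a ^+ 2, entry 1 x = 2 * a * b &
        entry 2 x = a ^+ 2 + b ^+ 2]].
Proof.
rewrite cornetP; split=> [[x0 xy xz]|[a [b [a0 ab [-> -> ->]]]]]; last first.
  have a20 : 0 < a ^+ 2 by rewrite exprn_gt0.
  have : 0 < a ^+ 2 * (1 - (a ^+ 2 + b ^+ 2)) by rewrite mulr_gt0// subr_gt0.
  by split; [lra|lra|ring].
have s0 : 0 < Num.sqrt (entry 0 x / 2) by rewrite sqrtr_gt0; lra.
have s2 : Num.sqrt (entry 0 x / 2) ^+ 2 = entry 0 x / 2.
  by rewrite sqr_sqrtr//; lra.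
move: s0 s2 x0 xy xz; set a := Num.sqrt _; clearbody a.
move: (entry 0 x) (entry 1 x) (entry 2 x) => u v w a0 a2 u0 uv uw.
have {a2}ua : u = 2 * a ^+ 2 by rewrite a2; field.
have vb : v = 2 * a * (v / (2 * a)) by field; rewrite gt_eqF.
exists a, (v / (2 * a)); move: vb; move: (v / _) => b vb; subst u v.
have a20 : 0 < 4 * a ^+ 2 by nra.
have wE : w = a ^+ 2 + b ^+ 2.
  by apply: (mulfI (lt0r_neq0 a20)); lra.
split=> //; rewrite -(ltr_pM2l a20); lra.
Qed.

(** The square root is eliminated: for [x > 0], [t - c = y / sqrt (2 x)] holds exactly when
    [2 x (t - c)^2 = y^2] and [y (t - c) >= 0]. *)
Lemma slit_function_semialgebraic c :
  continuous_semialgebraic (cornet R) (slit_function c).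
Proof.
split.
  apply: continuous_in_subspaceT => x; rewrite inE => /cornetP[x0 _ _].
  apply: (@continuousD _ _ _ (fun y => entry 1 y / Num.sqrt (2 * entry 0 y))
    (fun=> c)); last exact: cst_continuous.
  apply: (@continuousM _ _ (fun y => entry 1 y)
    (fun y => (Num.sqrt (2 * entry 0 y))^-1)).
    by apply: polynomial_continuous; polynomiality.
  apply: continuousV; first by rewrite gt_eqF// sqrtr_gt0; lra.
  by apply: continuous_sqrt_polynomial; polynomiality.
pose F (x : 'rV[R]_4) := entry 0 x.
pose E (x : 'rV[R]_4) := 2 * entry 0 x - (entry 0 x ^+ 2 + entry 1 x ^+ 2).
pose G (x : 'rV[R]_4) :=
  2 * entry 0 x * entry 2 x - (entry 0 x ^+ 2 + entry 1 x ^+ 2).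
pose H (x : 'rV[R]_4) := 2 * entry 0 x * (entry 3 x - c) ^+ 2 - entry 1 x ^+ 2.
pose K (x : 'rV[R]_4) := entry 1 x * (entry 3 x - c).
suff -> : cell_section (cornet R) (slit_function c) =
    [set x | 0 < F x] `&` ([set x | 0 < E x] `&` ([set x | G x = 0] `&`
    ([set x | H x = 0] `&` [set x | 0 <= K x]))).
  apply: semialgebraic_inter; first by apply: semialgebraic_gt0; rewrite /F; polynomiality.
  apply: semialgebraic_inter; first by apply: semialgebraic_gt0; rewrite /E; polynomiality.
  apply: semialgebraic_inter; first by apply: semialgebraic_eq0; rewrite /G; polynomiality.
  apply: semialgebraic_inter; first by apply: semialgebraic_eq0; rewrite /H; polynomiality.
  by apply: semialgebraic_ge0; rewrite /K; polynomiality.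
rewrite /cell_section /slit_function /F /G /E /H /K; apply/seteqP; split=> x /=;
  rewrite cornetP ord_maxE !entry_rV_init//;
  move: (entry 0 x) (entry 1 x) (entry 2 x) (entry 3 x) => u v w t.
  move=> [[u0 uv uw] ->]; rewrite addrK.
  have s0 : 0 < Num.sqrt (2 * u) by rewrite sqrtr_gt0; lra.
  split=> //; split; first lra; split; first lra; split.
    by rewrite exprMn exprVn sqr_sqrtr; [field; rewrite gt_eqF|lra].
  by rewrite mulrA -expr2 mulr_ge0 ?sqr_ge0// invr_ge0 ltW.
move=> [u0 [uv [uw [tH tK]]]]; split; first by split=> //; lra.
have s0 : 0 < Num.sqrt (2 * u) by rewrite sqrtr_gt0; lra.
have s2 : Num.sqrt (2 * u) ^+ 2 = 2 * u by rewrite sqr_sqrtr//; lra.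
suff -> : v = (t - c) * Num.sqrt (2 * u) by rewrite mulfK ?gt_eqF// subrK.
have vst : v ^+ 2 = ((t - c) * Num.sqrt (2 * u)) ^+ 2.
  by rewrite exprMn s2; lra.
have vs0 : 0 <= v * ((t - c) * Num.sqrt (2 * u)).
  by rewrite mulrA mulr_ge0// ltW.
move: vst vs0; move: ((t - c) * _) => z vz zv.
(* Equal squares give [v = z] or [v = - z]; in the second case the sign condition forces [z = 0]. *)
have /eqP := vz; rewrite eqf_sqr => /orP[/eqP //|/eqP vE].
move: zv; rewrite vE mulNr -expr2 oppr_ge0 exprn_even_le0//= => /eqP ->.
by rewrite oppr0.
Qed.

Lemma half_disc_chartE c a b :
  let x := half_disc_chart c (vec 1 [:: a; b]) in
  [/\ entry 0 x = 2 * a ^+ 2, entry 1 x = 2 * a * b,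
      entry 2 x = a ^+ 2 + b ^+ 2 & entry 3 x = b + c].
Proof. by rewrite /half_disc_chart !entry_vec. Qed.

Lemma eq_rV4 (x y : 'rV[R]_4) :
  entry 0 x = entry 0 y -> entry 1 x = entry 1 y -> entry 2 x = entry 2 y ->
  entry 3 x = entry 3 y -> x = y.
Proof. by move=> *; apply: eq_entry => -[|[|[|[|k]]]]. Qed.

Lemma eq_rV2 (x y : 'rV[R]_2) :
  entry 0 x = entry 0 y -> entry 1 x = entry 1 y -> x = y.
Proof. by move=> *; apply: eq_entry => -[|[|k]]. Qed.

(** * Regularity of the sections *)

Lemma cornet_section_chart c (x : 'rV[R]_4) :
  cell_section (cornet R) (slit_function c) x <->
  exists a b : R, [/\ 0 < a, a ^+ 2 + b ^+ 2 < 1 &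
    x = half_disc_chart c (vec 1 [:: a; b])].
Proof.
split=> [[/cornet_half_disc[a [b [a0 ab [xa xb xc]]]]]|[a [b [a0 ab ->]]]].
  rewrite ord_maxE (slit_functionP c a0 xa xb) => xt; exists a, b; split=> //.
  move: xa xb xc; rewrite !entry_rV_init// => xa xb xc.
  have [h0 h1 h2 h3] := half_disc_chartE c a b.
  by apply: eq_rV4; rewrite ?h0 ?h1 ?h2 ?h3.
have [h0 h1 h2 h3] := half_disc_chartE c a b.
split; first by apply/cornet_half_disc; exists a, b; rewrite !entry_rV_init.
by rewrite ord_maxE (@slit_functionP a b) ?entry_rV_init.
Qed.

Lemma half_disc_chart_continuous c : continuous (half_disc_chart c).
Proof.
apply: vec_continuous => -[|[|[|[|k]]]] //= _; apply: polynomial_continuous;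
  polynomiality.
Qed.

(** This recovers [a = sqrt (x / 2)] and [b = t - c], then stretches the chord [0 < a < s] to the
    full chord from [- s] to [s], where [s = sqrt (1 - b^2)]. As [Num.sqrt] is 0 on negative
    numbers, the formula is continuous on the whole space. *)
Definition section_to_disc (c : R) (x : 'rV[R]_4) : 'rV[R]_2 :=
  vec 1 [:: 2 * Num.sqrt (entry 0 x / 2) - Num.sqrt (1 - (entry 3 x - c) ^+ 2);
            entry 3 x - c].

(* Affine on each horizontal chord of the disc. *)
Definition disc_to_half_disc (v : 'rV[R]_2) : 'rV[R]_2 :=
  vec 1 [:: (entry 0 v + Num.sqrt (1 - entry 1 v ^+ 2)) / 2; entry 1 v].

Lemma section_to_disc_continuous c : continuous (section_to_disc c).
Proof.
apply: vec_continuous => -[|[|k]] //= _; last first.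
  by apply: polynomial_continuous; polynomiality.
move=> x; apply: (@continuousB _ _ _
  (fun x => 2 * Num.sqrt (entry 0 x / 2))
  (fun x => Num.sqrt (1 - (entry 3 x - c) ^+ 2))).
  apply: (@continuousM _ _ (fun=> 2) (fun x => Num.sqrt (entry 0 x / 2))).
    exact: cst_continuous.
  by apply: continuous_sqrt_polynomial; polynomiality.
by apply: continuous_sqrt_polynomial; polynomiality.
Qed.

Lemma disc_to_half_disc_continuous : continuous disc_to_half_disc.
Proof.
apply: vec_continuous => -[|[|k]] //= _; last first.
  by apply: polynomial_continuous; polynomiality.
move=> x; apply: (@continuousM _ _
  (fun x => entry 0 x + Num.sqrt (1 - entry 1 x ^+ 2)) (fun=> 2^-1)).
  apply: (@continuousD _ _ _ (fun x => entry 0 x)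
    (fun x => Num.sqrt (1 - entry 1 x ^+ 2))).
    by apply: polynomial_continuous; polynomiality.
  by apply: continuous_sqrt_polynomial; polynomiality.
exact: cst_continuous.
Qed.

Lemma unit_discP (v : 'rV[R]_2) :
  euclidean_ball 0 1 v <-> entry 0 v ^+ 2 + entry 1 v ^+ 2 < 1.
Proof.
rewrite /euclidean_ball /= expr1n big_ord_recr big_ord1 /=.
rewrite !mxE !subr0 ord_maxE.
by rewrite (_ : widen_ord _ _ = ord0) ?ord0E//; exact: val_inj.
Qed.

Lemma regular_cornet_section c :
  regular_set (cell_section (cornet R) (slit_function c)).
Proof.
right; exists 2%N, 0, 1; split=> //.
exists (section_to_disc c), (half_disc_chart c \o disc_to_half_disc).
have sectE a b : 0 < a ->
    section_to_disc c (half_disc_chart c (vec 1 [:: a; b])) =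
    vec 1 [:: 2 * a - Num.sqrt (1 - b ^+ 2); b].
  move=> a0; rewrite /section_to_disc.
  have [-> _ _ ->] := half_disc_chartE c a b.
  have -> : 2 * a ^+ 2 / 2 = a ^+ 2 by field.
  by rewrite addrK sqrtr_sqr ger0_norm// ltW.
(* With [s = sqrt (1 - y^2)], a point of the disc has [- s < x < s], hence [0 < (x + s) / 2 < s]. *)
have halfP (v : 'rV[R]_2) : euclidean_ball 0 1 v ->
    let a := (entry 0 v + Num.sqrt (1 - entry 1 v ^+ 2)) / 2 in
    0 < a /\ a ^+ 2 + entry 1 v ^+ 2 < 1.
  move=> /unit_discP; move: (entry 0 v) (entry 1 v) => x y xy /=.
  have s0 := sqrtr_ge0 (1 - y ^+ 2).
  have s2 : Num.sqrt (1 - y ^+ 2) ^+ 2 = 1 - y ^+ 2.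
    by rewrite sqr_sqrtr//; nra.
  move: s0 s2; move: (Num.sqrt _) => s s0 s2.
  have /andP[xs1 xs2] : - s < x < s by apply/andP; split; nra.
  by split; nra.
apply: pair_homeomorphism_closure.
- exact: norm_hausdorff.
- exact: norm_hausdorff.
- exact: section_to_disc_continuous.
- move=> v; apply: continuous_comp; first exact: disc_to_half_disc_continuous.
  exact: half_disc_chart_continuous.
- move=> _ /cornet_section_chart[a [b [a0 ab ->]]]; apply/unit_discP.
  rewrite sectE// !entry_vec//=.
  have s0 := sqrtr_ge0 (1 - b ^+ 2).
  have s2 : Num.sqrt (1 - b ^+ 2) ^+ 2 = 1 - b ^+ 2.
    by rewrite sqr_sqrtr//; nra.
  move: s0 s2; move: (Num.sqrt _) => s s0 s2.
  (* From [0 < a < s] follows [- s < 2 a - s < s], which is membership in the open disc. *)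
  have as1 : a < s by nra.
  nra.
- move=> v /halfP /= [a0 ab]; apply/cornet_section_chart.
  by do 2 eexists; split; [exact: a0|exact: ab|].
- move=> x; rewrite inE => /cornet_section_chart[a [b [a0 ab ->]]] /=.
  rewrite sectE//; congr half_disc_chart; apply: eq_rV2; rewrite !entry_vec//=.
  by rewrite subrK; field.
- move=> v; rewrite inE => vB /=; have [a0 _] := halfP _ vB.
  rewrite sectE//; apply: eq_rV2; rewrite !entry_vec//=.
  by rewrite mulrC divfK ?pnatr_eq0// addrK.
Qed.

(** * Non-regularity of the sector *)

Lemma slit_sector_not_regular :
  ~ regular_set (cell_sector (cornet R)
      (EFin \o slit_function 0) (EFin \o slit_function 2)).
Proof.
set S := cell_sector _ _ _.
(* The shift [1 - b] keeps the last coordinate equal to 1. As [a] tends to 0, [q b a] tends to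
   [(0, 0, b^2, 1)], which depends only on [b^2]. *)
pose q (b a : R) : 'rV[R]_4 := half_disc_chart (1 - b) (vec 1 [:: a; b]).
have qE (b a : R) : [/\ entry 0 (q b a) = 2 * a ^+ 2,
    entry 1 (q b a) = 2 * a * b, entry 2 (q b a) = a ^+ 2 + b ^+ 2 &
    entry 3 (q b a) = 1].
  by have [-> -> -> ->] := half_disc_chartE (1 - b) a b; split=> //; ring.
(* Over this point of the cornet the sector is the interval from [b] to [b + 2], which contains the
   height 1 because [-1 < b < 1]. *)
have SP a b : 0 < a -> a ^+ 2 + b ^+ 2 < 1 -> -1 < b < 1 -> S (q b a).
  move=> a0 ab b1; have [q0 q1 q2 q3] := qE b a; split.
    by apply/cornet_half_disc; exists a, b; rewrite !entry_rV_init.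
  rewrite ord_maxE q3 /= !lte_fin !(@slit_functionP a b) ?entry_rV_init//.
  by apply/andP; split; lra.
have qP b (b2 : b ^+ 2 = 1 / 4) (A : set 'rV[R]_4) : nbhs (q b 0) A ->
    exists t, [/\ 0 < t, S (q b t) & A (q b t)].
  have cq : continuous (q b).
    move=> t; apply: (@continuous_comp _ _ _ (fun t => vec 1 [:: t; b])).
      apply: vec_continuous => -[|[|k]] //= _ s; first exact: cvg_id.
      exact: cst_continuous.
    exact: half_disc_chart_continuous.
  (* The bound [e / 2] keeps [q b t] in the neighbourhood, and [1 / 2] keeps [(t, b)] in the
     half-disc, since [t^2 + b^2 <= 1 / 2]. *)
  move=> /cq /nbhs_ballP[e /= e0 eA]; pose t := Num.min (e / 2) (1 / 2).
  have t0 : 0 < t by rewrite lt_min; apply/andP; split; lra.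
  have te : t <= e / 2 by rewrite ge_min lexx.
  have t12 : t <= 1 / 2 by rewrite ge_min lexx orbT.
  exists t; split=> //.
    by apply: SP => //; [nra|apply/andP; split; nra].
  by apply: eA; rewrite /ball /= sub0r normrN gtr0_norm//; lra.
(* The glued point [(0, 0, 1 / 4, 1)] is reached from the side [y > 0] with [b = 1 / 2] and from the
   side [y < 0] with [b = - 1 / 2]. *)
pose p := q (1 / 2) 0.
have pE : p = q (- (1 / 2)) 0.
  have [p0 p1 p2 p3] := qE (1 / 2) 0; have [m0 m1 m2 m3] := qE (- (1 / 2)) 0.
  by apply: eq_rV4; rewrite ?p0 ?p1 ?p2 ?p3 ?m0 ?m1 ?m2 ?m3// ?sqrrN// !mulr0 !mul0r.
(* Where [x < z], a point of the cornet has [y != 0]: [y = 0] would give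
   [x = 2 z]. *)
apply: (@not_regular_split_boundary _ _ S
  [set x | 0 < entry 2 x - entry 0 x] (fun x => entry 1 x) p).
- by apply: polynomial_continuous; polynomiality.
- have cU : continuous (fun x : 'rV[R]_4 => entry 2 x - entry 0 x).
    by apply: polynomial_continuous; polynomiality.
  apply: (cU p [set t | 0 < t]); apply: lt_nbhsr.
  by have [-> _ -> _] := qE (1 / 2) 0; lra.
- move=> x [/cornetP[]]; rewrite !entry_rV_init// => x0 _ xz _ /= xlz.
  apply/eqP => y0; move: x0 xz xlz; rewrite y0 {y0}.
  by move: (entry 0 x) (entry 2 x) => {x} u w u0 uw; nra.
- rewrite pE => A /qP[|t [t0 St At]]; first by rewrite sqrrN; field.
  exists (q (- (1 / 2)) t); split=> //; split=> //=.
  by have [_ -> _ _] := qE (- (1 / 2)) t; lra.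
- move=> A /qP[|t [t0 St At]]; first by field.
  exists (q (1 / 2) t); split=> //; split=> //=.
  by have [_ -> _ _] := qE (1 / 2) t; lra.
Qed.

End Cornet.

Theorem proposition3p8 (R : realType) :
  exists l u : 'rV[R]_3 -> R,
    continuous_semialgebraic (cornet R) l /\
    continuous_semialgebraic (cornet R) u /\
    (forall x : 'rV[R]_3, cornet R x -> (l x < u x)%R) /\
    cad_cell (cell_sector (cornet R) (EFin \o l) (EFin \o u)) /\
    ~ regular_set (cell_sector (cornet R) (EFin \o l) (EFin \o u)) /\
    regular_set (cell_section (cornet R) l) /\
    regular_set (cell_section (cornet R) u).
Proof.
(* At height [z < 1] the two side limits of the lower bound differ by [2 sqrt z < 2], so a gap of 2
   makes the two intervals over the slit overlap. *)
exists (slit_function 0), (slit_function 2).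
have lu (x : 'rV[R]_3) : slit_function 0 x < slit_function 2 x.
  by rewrite /slit_function ltrD2l.
split; first exact: slit_function_semialgebraic.
split; first exact: slit_function_semialgebraic.
split; first by move=> x _.
split.
  apply: cad_cell_sector; first exact: cad_cell_cornet.
  - by right; exists (slit_function 0) => //; exact: slit_function_semialgebraic.
  - by right; exists (slit_function 2) => //; exact: slit_function_semialgebraic.
  - by move=> x _; rewrite /= lte_fin.
split; first exact: slit_sector_not_regular.
by split; exact: regular_cornet_section.
Qed.
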